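(* Assume $K_2=1$ in (A2), $r_k\ge4/7$ for all $k\ge2$, $\kappa\ge\|f'\|_{C[-\beta,\beta]}$, $\|\phi^0\|_\infty\le\beta$, and $$\tau_1\le\min\Big\{\Big(\frac{4}{11\varsigma m(\kappa+4\varepsilon^2/h^2)\Gamma(2-\alpha)}\Big)^{1/\alpha},\Big(\frac{4}{11\kappa(1-\varsigma)m\Gamma(2-\alpha)}\Big)^{1/\alpha}\Big\}.$$ If moreover for all $n\ge1$ $$\tau_n\le\Big(\frac{4}{11(1-\varsigma)m(4\varepsilon^2/h^2+\kappa)\Gamma(2-\alpha)}\Big)^{1/\alpha},$$ then the solution of the unbalanced $L2$-$1_\sigma$-sESAV scheme satisfies $\|\phi^n\|_\infty\le\beta$ for all $n\ge1$.
   Context: Setting: $\Omega=(0,L)^2$ with periodic boundary conditions; constants $m>0$, $\varepsilon>0$, $\alpha\in(0,1)$, and $\varsigma:=\alpha/2$. The nonlinearity $f=-F'$ is one of: (double-well) $F(\phi)=\frac14(1-\phi^2)^2$, $f(\phi)=\phi-\phi^3$, with $\beta=1$; or (Flory–Huggins) $F(\phi)=\frac{\theta}{2}[(1+\phi)\ln(1+\phi)+(1-\phi)\ln(1-\phi)]-\frac{\theta_c}{2}\phi^2$, $f(\phi)=\frac{\theta}{2}\ln\frac{1-\phi}{1+\phi}+\theta_c\phi$ on $(-1,1)$, with $\theta_c>\theta>0$ and $\beta\in(0,1)$ the positive root of $f$. In both cases $f(\pm\beta)=0$. Spatial discretization: $M\in\mathbb N$, $h=L/M$; $\mathbb V_h$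 is the space of real grid functions $v=\{v_{ij}\}_{i,j\in\mathbb Z}$ that are $M$-periodic in each index; $\langle v,w\rangle=h^2\sum_{i,j=1}^Mv_{ij}w_{ij}$, $\|v\|_\infty=\max_{1\le i,j\le M}|v_{ij}|$; $\Delta_hv_{ij}=h^{-2}(v_{i+1,j}+v_{i-1,j}+v_{i,j+1}+v_{i,j-1}-4v_{ij})$. Scalar functions act on grid functions pointwise. $E_{1h}[v]=\langle F(v),1\rangle$ and $g_h(v,w)=\exp(w)/\exp(E_{1h}[v])$ for $v\in\mathbb V_h$ (with $\|v\|_\infty<1$ in the Flory–Huggins case) and $w\in\mathbb R$. Auxiliary functional: $V:\mathbb R\to\mathbb R$ satisfies (A1) $V\in C^1(\mathbb R)\cap W^{2,\infty}(\mathbb R)$, $V(1)=1$, $V'(1)=0$, $|V'|\le K_1$; (A2) $0\le V\le K_2$ for a constant $K_2>0$; (A3) $|z_1-1|\le|z_2-1|$ implies $|V(z_1)-1|\le|V(z_2)-1|$. Time grid: $0=t_0<t_1<\dots<t_N=T$, $\tau_k=t_k-t_{k-1}$, $r_k=\tau_k/\tau_{k-1}$ ($k\ge2$), $\nabla_\tau v^k=v^k-v^{k-1}$, $\mathbb D_\tau v^k=\nabla_\tau v^k/\tau_k$, $\omega_\mu(t)=t^{\mu-1}/\Gamma(\mu)$. Constant $\kappa\ge0$; data $\phi^0\in\mathbb V_h$, $R^0\in\mathbb R$. For $n\ge2$ the predicted solution is $\hat\phi^n=\min\{\max\{(1+r_n)\phi^{n-1}-r_n\phi^{n-2},-\beta\},\beta\}$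 (pointwise). $L2$-$1_\sigma$ discretization: $t_{k-\varsigma}=(1-\varsigma)t_k+\varsigma t_{k-1}$, $t_{k-1/2}=(t_k+t_{k-1})/2$; $a^{(n)}_{n-k}=\frac1{\tau_k}\int_{t_{k-1}}^{\min\{t_k,t_{n-\varsigma}\}}\omega_{1-\alpha}(t_{n-\varsigma}-s)\,ds$ ($1\le k\le n$), $b^{(n)}_{n-k}=\frac{2}{\tau_k(\tau_k+\tau_{k+1})}\int_{t_{k-1}}^{t_k}(s-t_{k-1/2})\omega_{1-\alpha}(t_{n-\varsigma}-s)\,ds$ ($1\le k\le n-1$); $B^{(1)}_0=a^{(1)}_0$, and for $n\ge2$: $B^{(n)}_0=a^{(n)}_0+b^{(n)}_1/r_n$, $B^{(n)}_{n-k}=a^{(n)}_{n-k}+b^{(n)}_{n-k+1}/r_k-b^{(n)}_{n-k}$ for $2\le k\le n-1$, $B^{(n)}_{n-1}=a^{(n)}_{n-1}-b^{(n)}_{n-1}$; $\tilde{\mathbb D}^\alpha_\tau v^n=\sum_{k=1}^nB^{(n)}_{n-k}\nabla_\tau v^k$; $w^{k-\varsigma}=(1-\varsigma)w^k+\varsigma w^{k-1}$. Unbalanced $L2$-$1_\sigma$-sESAV scheme: $\hat\phi^1\in\mathbb V_h$ with $\|\hat\phi^1\|_\infty\le\beta$ solves $B^{(1)}_0(\hat\phi^1-\phi^0)=m(\varepsilon^2\Delta_h\hat\phi^{1-\varsigma}+f(\hat\phi^{1-\varsigma}))$; for $n\ge2$, $\hat\phi^n$ is the predicted solution above. For $n\ge1$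 set $\hat\phi^{n-\varsigma}=(1-\varsigma)\hat\phi^n+\varsigma\phi^{n-1}$ and $V^{n-\varsigma}=V(g_h(\hat\phi^{n-\varsigma},R^{n-1}))$, and define $(\phi^n,R^n)$ by $\tilde{\mathbb D}^\alpha_\tau\phi^n=m(\varepsilon^2\Delta_h\phi^{n-\varsigma}+V^{n-\varsigma}f(\hat\phi^{n-\varsigma})-\kappa(\phi^{n-\varsigma}-V^{n-\varsigma}\hat\phi^{n-\varsigma}))$ and $\mathbb D_\tau R^n=-V^{n-\varsigma}\langle f(\hat\phi^{n-\varsigma}),\mathbb D_\tau\phi^n\rangle+\kappa\langle\phi^{n-\varsigma}-V^{n-\varsigma}\hat\phi^{n-\varsigma},\mathbb D_\tau\phi^n\rangle$. *)

(* Defs.v *)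
From HB Require Import structures.
From mathcomp Require Import all_boot all_order all_algebra.
From mathcomp Require Import all_classical all_reals all_analysis.
Set Implicit Arguments. Unset Strict Implicit. Unset Printing Implicit Defensive.
Import Order.TTheory GRing.Theory Num.Theory.
Import numFieldNormedType.Exports.
Local Open Scope classical_set_scope.
Local Open Scope ring_scope.

Section Defs.
Variable R : realType.

Definition GammaF (mu : R) : R :=
  Rintegral lebesgue_measure `]0%R, +oo[%classic
    (fun s => powR s (mu - 1) * expR (- s)).

Definition omega (mu t : R) : R := powR t (mu - 1) / GammaF mu.

Variant potential := DoubleWell | FloryHuggins of R & R (* theta, theta_c *).

Definition Fpot (p : potential) (x : R) : R :=
  match p with
  | DoubleWell => (1 - x ^+ 2) ^+ 2 / 4
  | FloryHuggins th thc =>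
      th / 2 * ((1 + x) * ln (1 + x) + (1 - x) * ln (1 - x)) - thc / 2 * x ^+ 2
  end.

Definition fpot (p : potential) (x : R) : R :=
  match p with
  | DoubleWell => x - x ^+ 3
  | FloryHuggins th thc => th / 2 * ln ((1 - x) / (1 + x)) + thc * x
  end.

Definition potential_ok (p : potential) (beta : R) : Prop :=
  match p with
  | DoubleWell => beta = 1
  | FloryHuggins th thc => 0 < th /\ th < thc /\ 0 < beta /\ beta < 1 /\ fpot p beta = 0
  end.

(* ---------- spatial grid: M-periodic grid functions ---------- *)
Definition grid (M : nat) := 'I_M -> 'I_M -> R.

Definition lap_h (M : nat) (h : R) (v : grid M) : grid M :=
  fun i j => h ^- 2 * (v (ordS i) j + v (ord_pred i) j + v i (ordS j)
                       + v i (ord_pred j) - 4 * v i j).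

Definition inner_h (M : nat) (h : R) (v w : grid M) : R :=
  h ^+ 2 * \sum_(i < M) \sum_(j < M) v i j * w i j.

Definition normInf (M : nat) (v : grid M) : R :=
  \big[Num.max/0]_(i < M) \big[Num.max/0]_(j < M) `|v i j|.

Definition E1h (p : potential) (M : nat) (h : R) (v : grid M) : R :=
  inner_h h (fun i j => Fpot p (v i j)) (fun _ _ => 1).

Definition g_h (p : potential) (M : nat) (h : R) (v : grid M) (w : R) : R :=
  expR w / expR (E1h p h v).

(* tau k = tau_k for k >= 1 ; t k = tau_1 + ... + tau_k *)
Definition tgrid (tau : nat -> R) (k : nat) : R := \sum_(1 <= j < k.+1) tau j.
Definition step_ratio (tau : nat -> R) (k : nat) : R := tau k / tau k.-1.

Definition tshift (tau : nat -> R) (sg : R) (n : nat) : R :=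
  (1 - sg) * tgrid tau n + sg * tgrid tau n.-1.

(* a^{(n)}_{n-k}, 1 <= k <= n *)
Definition acoef (tau : nat -> R) (alpha : R) (n k : nat) : R :=
  let sg := alpha / 2 in
  let tn := tshift tau sg n in
  (tau k)^-1 * Rintegral lebesgue_measure
    `[tgrid tau k.-1, Num.min (tgrid tau k) tn]%classic
    (fun s => omega (1 - alpha) (tn - s)).

(* b^{(n)}_{n-k}, 1 <= k <= n-1 *)
Definition bcoef (tau : nat -> R) (alpha : R) (n k : nat) : R :=
  let sg := alpha / 2 in
  let tn := tshift tau sg n in
  2 / (tau k * (tau k + tau k.+1)) * Rintegral lebesgue_measure
    `[tgrid tau k.-1, tgrid tau k]%classic
    (fun s => (s - (tgrid tau k + tgrid tau k.-1) / 2) * omega (1 - alpha) (tn - s)).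

(* Bcoef tau alpha n k = B^{(n)}_{n-k}, 1 <= k <= n *)
Definition Bcoef (tau : nat -> R) (alpha : R) (n k : nat) : R :=
  if n == 1%N then acoef tau alpha 1 1
  else if k == n then acoef tau alpha n n + bcoef tau alpha n n.-1 / step_ratio tau n
  else if k == 1%N then acoef tau alpha n 1 - bcoef tau alpha n 1
  else acoef tau alpha n k + bcoef tau alpha n k.-1 / step_ratio tau k - bcoef tau alpha n k.

Definition caputo (M : nat) (tau : nat -> R) (alpha : R) (v : nat -> grid M)
  (n : nat) : grid M :=
  fun i j => \sum_(1 <= k < n.+1) Bcoef tau alpha n k * (v k i j - v k.-1 i j).

Definition clamp (beta x : R) : R := Num.min (Num.max x (- beta)) beta.

Definition hatphi (M : nat) (tau : nat -> R) (beta : R) (phi : nat -> grid M)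
  (hat1 : grid M) (n : nat) : grid M :=
  if n == 1%N then hat1
  else fun i j => clamp beta ((1 + step_ratio tau n) * phi n.-1 i j
                              - step_ratio tau n * phi n.-2 i j).

Definition scheme_solution (p : potential) (beta : R) (V : R -> R)
  (m eps alpha kappa L : R) (M N : nat) (tau : nat -> R)
  (phi : nat -> grid M) (Rs : nat -> R) (hat1 : grid M) : Prop :=
  let sg := alpha / 2 in
  let h := L / M%:R in
  let f := fpot p in
  ((1 <= N)%N ->
     normInf hat1 <= beta /\
     let hs := fun i j => (1 - sg) * hat1 i j + sg * phi 0%N i j in
     forall i j, Bcoef tau alpha 1 1 * (hat1 i j - phi 0%N i j)
                 = m * (eps ^+ 2 * lap_h h hs i j + f (hs i j))) /\
  (forall n, (1 <= n <= N)%N ->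
     let hat := hatphi tau beta phi hat1 n in
     let hs := fun i j => (1 - sg) * hat i j + sg * phi n.-1 i j in
     let ps := fun i j => (1 - sg) * phi n i j + sg * phi n.-1 i j in
     let Vn := V (g_h p h hs (Rs n.-1)) in
     let Dphi := fun i j => (phi n i j - phi n.-1 i j) / tau n in
     (forall i j, caputo tau alpha phi n i j
        = m * (eps ^+ 2 * lap_h h ps i j + Vn * f (hs i j)
               - kappa * (ps i j - Vn * hs i j))) /\
     (Rs n - Rs n.-1) / tau n
        = - Vn * inner_h h (fun i j => f (hs i j)) Dphi
          + kappa * inner_h h (fun i j => ps i j - Vn * hs i j) Dphi).

Definition V_assumptions (V : R -> R) (K1 K2 : R) : Prop :=
  (* (A1): V in C^1 cap W^{2,oo}, V(1)=1, V'(1)=0, |V'| <= K1 *)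
  (forall x, derivable V x 1) /\ continuous (derive1 V) /\
  (exists C : R, forall x y, `|derive1 V x - derive1 V y| <= C * `|x - y|) /\
  V 1 = 1 /\ derive1 V 1 = 0 /\ (forall x, `|derive1 V x| <= K1) /\
  0 < K2 /\ (forall x, 0 <= V x <= K2) /\
  (forall z1 z2, `|z1 - 1| <= `|z2 - 1| -> `|V z1 - 1| <= `|V z2 - 1|).

End Defs.

(* Main.v *)
Require Import Defs.
From HB Require Import structures.
From mathcomp Require Import all_boot all_order all_algebra.
From mathcomp Require Import all_classical all_reals all_analysis.
From mathcomp Require Import measurable_realfun ring lra.
Import Order.TTheory GRing.Theory Num.Theory.
Import numFieldNormedType.Exports.
Local Open Scope classical_set_scope.
Local Open Scope ring_scope.

(** On the interval before [t_{n-sg}] the kernel [w(s) = omega_{1-alpha}(t_{n-sg} - s)]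
    is nonnegative, increasing and convex. Comparing it pointwise with affine
    functions gives, for [k < n],
      [w(t_{k-1}) <= B^{(n)}_{n-k} <= w(t_k)],
    the upper bound needing [3 r_k^2 (1 + r_k) >= 1], which [r_k >= 4/7] implies.
    The weakly singular integral [a^{(n)}_0] is explicit, and yields
      [w(t_{n-1}) = (1-alpha)/(1-sg) a^{(n)}_0 <= (1-alpha)/(1-sg) B^{(n)}_0].
    Hence the weights are nonnegative and monotone, with gap
      [B^{(n)}_0 - B^{(n)}_1 >= sg/(1-sg) B^{(n)}_0 >= m sg (4 eps^2/h^2 + kappa)],
    the last step being the restriction on [tau_n]. Each step then writes
    [(B_0 + m kappa (1-sg) - m eps^2 (1-sg) Delta_h) phi^n] as a nonnegative
    combination of past values plus [m V (f(x) + kappa x)] with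
    [|f(x) + kappa x| <= kappa beta], and the discrete maximum principle applies
    to [phi^n] and to [- phi^n]. *)

(** * Integrals of powers and the Gamma function *)

Section Calculus.
Context {R : realType}.
Notation mu := (@lebesgue_measure R).

Lemma continuous_segment_integrable (f : R -> R) (a b : R) :
  {within `[a, b], continuous f} -> mu.-integrable `[a, b] (EFin \o f).
Proof. by apply: continuous_compact_integrable; exact: segment_compact. Qed.

Lemma integral_segment_is_derive (F f : R -> R) (a b : R) : a < b ->
  (forall x, a <= x <= b -> is_derive x 1 F (f x)) ->
  {within `[a, b], continuous f} ->
  (\int[mu]_(x in `[a, b]) (f x)%:E = (F b - F a)%:E)%E.
Proof.
move=> ab dF cf.
have cF : {within `[a, b], continuous F}.
  apply: derivable_within_continuous => x; rewrite in_itv/= => /dF dFx.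
  exact: ex_derive.
have /(continuous_within_itvP _ ab)[_ Fa Fb] := cF.
rewrite EFinB (@continuous_FTC2 _ f F a b ab cf)//.
- split => // x; rewrite in_itv/= => /andP[ax xb].
  have /dF dFx : a <= x <= b by rewrite !ltW.
  exact: ex_derive.
- move=> x; rewrite in_itv/= => /andP[ax xb].
  have /dF dFx : a <= x <= b by rewrite !ltW.
  by rewrite derive1E derive_val.
Qed.

(** Writing a bound as the integral of such a polynomial reduces the estimates below to pointwise
    inequalities. *)
Lemma Rintegral_quadratic (a b q c0 c1 c2 : R) : a < b ->
  \int[mu]_(x in `[a, b]) (c0 + c1 * (x - q) + c2 * (x - q) ^+ 2) =
  c0 * (b - a) + c1 * ((b - q) ^+ 2 - (a - q) ^+ 2) / 2
  + c2 * ((b - q) ^+ 3 - (a - q) ^+ 3) / 3.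
Proof.
move=> ab.
pose F x := c0 * x + c1 / 2 * (x - q) ^+ 2 + c2 / 3 * (x - q) ^+ 3.
pose f x := c0 + c1 * (x - q) + c2 * (x - q) ^+ 2.
have dF x : a <= x <= b -> is_derive x 1 F (f x).
  move=> _; apply: is_derive_eq.
  by rewrite /f /GRing.scale/=; field.
have cf : {within `[a, b], continuous f}.
  by apply: derivable_within_continuous => x _; exact: ex_derive.
by rewrite /Rintegral (integral_segment_is_derive F f a b ab dF cf)/= /F; field.
Qed.

Lemma within_continuous_mul_sub (w : R -> R) (a b q : R) :
  {within `[a, b], continuous w} ->
  {within `[a, b], continuous (fun s => (s - q) * w s)}.
Proof.
move=> cw.
have cq : {within `[a, b], continuous (fun s => s - q)}.
  by apply: derivable_within_continuous => x _; exact: ex_derive.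
by move=> x; apply: cvgM; [exact: cq|exact: cw].
Qed.

Lemma integrable_quadratic (a b q c0 c1 c2 : R) :
  mu.-integrable `[a, b] (EFin \o (fun x => c0 + c1 * (x - q) + c2 * (x - q) ^+ 2)).
Proof.
apply: continuous_segment_integrable.
by apply: derivable_within_continuous => x _; exact: ex_derive.
Qed.

Lemma is_derive_powR_sub (y r x : R) : x < y ->
  is_derive x 1 (fun s => powR (y - s) r) (- r * powR (y - x) (r - 1)).
Proof.
move=> xy.
have yx : 0 < y - x by rewrite subr_gt0.
have := @is_derive1_comp _ (fun z => powR z r) (fun s => y - s) x _ _
  (is_derive1_powR r yx) _.
move=> /(_ (-1) _) H.
have E : r * powR (y - x) (r - 1) * -1 = - r * powR (y - x) (r - 1) by ring.
rewrite -E; apply: H.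
by apply: is_derive_eq; ring.
Qed.
End Calculus.

(** * Integral of a power singular at an endpoint *)

Section Singular.
Context {R : realType}.
Notation mu := (@lebesgue_measure R).

Lemma within_continuous_powR_sub (y r a b : R) : b < y ->
  {within `[a, b], continuous (fun s => powR (y - s) r)}.
Proof.
move=> by_; apply: derivable_within_continuous => x.
rewrite in_itv/= => /andP[_ xb].
exact: (@ex_derive _ _ _ _ _ _ _ (is_derive_powR_sub y r x (le_lt_trans xb by_))).
Qed.

Lemma powR_cvg0_comp (u : nat -> R) (r : R) : 0 < r ->
  (forall n, 0 < u n) -> u @ \oo --> 0 -> powR (u n) r @[n --> \oo] --> 0.
Proof.
move=> r0 u0 cu.
by have /cvg_at_rightP := @powR_cvg0 R r r0; apply.
Qed.

(** The fundamental theorem of calculus applies on segments that stop short of [y]; monotone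
    convergence gives the rest, since [r + 1 > 0] makes the antiderivative vanish at [y]. *)
Lemma integral_powR_sub (x y r : R) : x < y -> -1 < r < 0 ->
  (\int[mu]_(s in `[x, y]) (powR (y - s) r)%:E =
     (powR (y - x) (r + 1) / (r + 1))%:E)%E.
Proof.
move=> xy /andP[r1 r0].
have r10 : 0 < r + 1 by lra.
have yx0 : 0 < y - x by rewrite subr_gt0.
pose f (s : R) : R := powR (y - s) r.
(* Dividing by [n.+2] rather than [n.+1] keeps [x < b n] strict already at [n = 0]. *)
pose b n : R := y - (y - x) / n.+2%:R.
have bx n : x < b n.
  by rewrite /b ltrBrDr -ltrBrDl ltr_pdivrMr// -[ltLHS]mulr1 ltr_pM2l// ltr1n.
have by_ n : b n < y by rewrite /b ltrBlDr ltrDl divr_gt0.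
have mf : measurable_fun setT f.
  by apply: (measurableT_comp (@measurable_powR R r)); exact: measurable_funB.
rewrite -integral_itv_bndo_bndc; last first.
  by apply/measurable_EFinP; exact: measurable_funTS.
have -> : `[x, y[%classic = \bigcup_n `[x, b n]%classic.
  apply/seteqP; split => s /=; rewrite ?in_itv/=.
    move=> /andP[xs sy].
    have e0 : 0 < (y - s) / (y - x) by rewrite divr_gt0// subr_gt0.
    have [n _ /(_ n (leqnn n))/= nlt] := near_infty_natSinv_lt (PosNum e0).
    exists n => //=; rewrite in_itv/= xs /b lerBrDr -lerBrDl.
    rewrite mulrC -ler_pdivlMr//; apply/ltW/(le_lt_trans _ nlt).
    by rewrite lef_pV2 ?posrE// ler_nat.
  by move=> [n _] /=; rewrite in_itv/= => /andP[-> /le_lt_trans]; apply.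
have cv : (\int[mu]_(s in `[x, b i]%classic) (f s)%:E)%E @[i --> \oo] -->
    (\int[mu]_(s in \bigcup_i `[x, b i]%classic) (f s)%:E)%E.
  apply: ge0_nondecreasing_set_cvg_integral => //.
  - move=> n m nm; rewrite subsetEset => s /=; rewrite !in_itv/= => /andP[-> /=].
    move=> /le_trans; apply; rewrite /b lerD2l lerN2 ler_pM2l// lef_pV2 ?posrE//.
    by rewrite ler_nat.
  - by move=> i; apply/measurable_EFinP; exact: measurable_funTS.
  - by move=> i s _; rewrite lee_fin powR_ge0.
have E n : (\int[mu]_(s in `[x, b n]) (f s)%:E =
   (powR (y - x) (r + 1) / (r + 1) - powR ((y - x) / n.+2%:R) (r + 1) / (r + 1))%:E)%E.
  pose F s : R := - powR (y - s) (r + 1) / (r + 1).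
  have dF s : x <= s <= b n -> is_derive s 1 F (f s).
    move=> /andP[_ sb]; have dP := is_derive_powR_sub y (r + 1) s (le_lt_trans sb (by_ n)).
    apply: is_derive_eq; rewrite /GRing.scale/= addrK /f; field.
    by rewrite gt_eqF.
  have cf := within_continuous_powR_sub y r x (b n) (by_ n).
  rewrite (integral_segment_is_derive F f x (b n) (bx n) dF cf) /F /b.
  by rewrite opprB addrCA subrr addr0; congr (_%:E); ring.

rewrite (funext E) in cv.
apply/esym; apply: (cvg_unique _ _ cv) => //=.

apply: cvg_EFin; first exact: nearW.
rewrite -[X in _ --> X]subr0 -(mul0r (r + 1)^-1).
apply: cvgB; first exact: cvg_cst.
apply: cvgMl.
apply: powR_cvg0_comp => // [n|]; first by rewrite divr_gt0.
rewrite -(mulr0 (y - x)); apply: cvgMr.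
by have := @cvg_harmonic R; rewrite -cvg_shiftS.
Qed.
End Singular.

(** * Recursion and positivity of the Gamma function *)

Section Gamma.
Context {R : realType}.
Notation mu := (@lebesgue_measure R).

Let G (p s : R) : R := powR s p * expR (- s).

Let G_ge0 p s : 0 <= G p s.
Proof. by rewrite mulr_ge0 ?powR_ge0 ?expR_ge0. Qed.

Let measurable_G p : measurable_fun setT (G p).
Proof.
apply: measurable_funM; first exact: measurable_powR.
by apply: measurableT_comp => //; exact: measurableT_comp.
Qed.

(** The chain [s^p <= 1 + s <= 2 e^(s/2)] spends half of the exponential decay on the power. *)
Let G_le (p s : R) : 0 <= p <= 1 -> 0 < s -> G p s <= 2 * expR (- (2^-1) * s).
Proof.
move=> /andP[p0 p1] s0.
have s1 : powR s p <= 1 + s.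
  have [sle1|/ltW sge1] := leP s 1.
    have : powR s p <= powR 1 p.
      by apply: ge0_ler_powR => //; rewrite ?nnegrE ?(ltW s0).
    by rewrite powR1 => /le_trans; apply; rewrite lerDl ltW.
  by rewrite (le_trans (ler1_powR sge1 p1))// lerDr.
have := expR_ge1Dx (2^-1 * s) => e1.
have -> : 2 * expR (- 2^-1 * s) = 2 * expR (2^-1 * s) * expR (- s).
  by rewrite -mulrA -expRD; congr (_ * expR _); field.
by rewrite ler_wpM2r ?expR_ge0//; lra.
Qed.

Let integrable_G (p : R) : 0 <= p <= 1 -> mu.-integrable `]0, +oo[ (EFin \o G p).
Proof.
move=> p01.
have h0 : 0 < 2^-1 :> R by [].
have ie := integrable_exponential_pdf h0.
have ie' : mu.-integrable `]0%R, +oo[ (EFin \o exponential_pdf (2^-1 : R)).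
  exact: (integrableS _ _ _ ie).
(* The exponential density of rate 1/2 is [e^(-s/2) / 2], so the factor 4 produces the majorant of
   [G_le]. *)
apply: le_integrable (integrableZl _ 4 ie') => //=.
- by apply/measurable_EFinP; exact: measurable_funTS (measurable_G _).
- move=> x /=; rewrite in_itv/= andbT => x0.
  rewrite lee_fin !ger0_norm// ?mulr_ge0 ?exponential_pdf_ge0//.
  rewrite exponential_pdfE ?(ltW x0)//.
  apply: (le_trans (G_le _ _ p01 x0)).
  by rewrite mulrA ler_wpM2r ?expR_ge0//; lra.
Qed.

(** Endpoints of segments exhausting the half-line; the shift by 2 ensures [a n < 1 < b n] for every
    [n]. *)
Let a n : R := n.+2%:R^-1.
Let b n : R := n.+2%:R.

Let a_gt0 n : 0 < a n. Proof. by rewrite /a invr_gt0. Qed.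
Let a_lt_b n : a n < b n.
Proof. by apply: (@lt_trans _ _ 1); rewrite ?/a ?invf_lt1// /b ltr1n. Qed.

(** The integrand is nonnegative, so monotone convergence holds in the extended reals for every [p],
    in particular for [p = q - 1 < 0], where integrability is not known beforehand. *)
Let G_cvg p : (\int[mu]_(s in `[a i, b i]%classic) (G p s)%:E)%E @[i --> \oo] -->
    (\int[mu]_(s in `]0%R, +oo[%classic) (G p s)%:E)%E.
Proof.
have -> : `]0, +oo[%classic = \bigcup_n `[a n, b n]%classic.
  apply/seteqP; split => s /=; rewrite ?in_itv/= ?andbT.
    move=> s0.
    have [n _ /(_ _)/= nlt] := near_infty_natSinv_lt (PosNum s0).
    pose m := maxn n (Num.truncn s).
    exists m => //=; rewrite in_itv/= /a /b; apply/andP; split.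
      rewrite (le_trans _ (ltW (nlt m _)))//= ?leq_max ?leqnn//.
      by rewrite lef_pV2 ?posrE// ler_nat.
    rewrite (le_trans (ltW (truncnS_gt s)))// ler_nat.
    by rewrite ltnW// !ltnS leq_max leqnn orbT.
  move=> [n _] /=; rewrite in_itv/= => /andP[+ _].
  exact: lt_le_trans.
apply: ge0_nondecreasing_set_cvg_integral => //.
- move=> n m nm; rewrite subsetEset => s /=; rewrite !in_itv/= => /andP[an nb].
  rewrite (le_trans _ an) ?(le_trans nb)// /a /b ?lef_pV2 ?posrE// ler_nat//.
- by move=> i; apply/measurable_EFinP; exact: measurable_funTS (measurable_G _).
- by move=> i s _; rewrite lee_fin.
Qed.

(** Integration by parts, from [(G q)' = q G (q - 1) - G q]. *)
Let G_FTC (q u v : R) : 0 < u -> u < v ->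
  q * \int[mu]_(s in `[u, v]) G (q - 1) s - \int[mu]_(s in `[u, v]) G q s =
  G q v - G q u.
Proof.
move=> u0 uv.
have dG r s : u <= s <= v ->
    is_derive s 1 (G r) (r * G (r - 1) s - G r s).
  move=> /andP[us _]; have s0 := lt_le_trans u0 us.
  have dP := is_derive1_powR r s0.
  apply: is_derive_eq; rewrite /G /GRing.scale/=; ring.
have cG r : {within `[u, v], continuous (G r)}.
  apply: derivable_within_continuous => s; rewrite in_itv/= => /dG => /(_ r) ?.
  exact: ex_derive.
have iG r := continuous_segment_integrable _ u v (cG r).
have cqG : {within `[u, v], continuous (fun s => q * G (q - 1) s)}.
  by move=> s; apply: cvgM; [exact: cvg_cst|exact: cG].
have iqG := continuous_segment_integrable _ u v cqG.
rewrite -RintegralZl// -RintegralB// /Rintegral.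
have cqGG : {within `[u, v], continuous (fun s => q * G (q - 1) s - G q s)}.
  by move=> s; apply: cvgB; [exact: cqG|exact: cG].
by rewrite (integral_segment_is_derive (G q) _ u v uv (dG q) cqGG).
Qed.

Let G_cvg0_right (q : R) : 0 < q -> G q (a n) @[n --> \oo] --> 0.
Proof.
move=> q0.
have a0 : powR (a n) q @[n --> \oo] --> 0.
  apply: powR_cvg0_comp => //.
  by have := @cvg_harmonic R; rewrite -cvg_shiftS.
apply: (squeeze_cvgr _ (cvg_cst 0) a0); apply: nearW => n; rewrite G_ge0/=.
by rewrite ler_piMr ?powR_ge0// -expR0 ler_expR oppr_le0 ltW.
Qed.

Let G_cvg0_left (q : R) : 0 <= q <= 1 -> G q (b n) @[n --> \oo] --> 0.
Proof.
move=> q01.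
have b0 : 2 * expR (- (2^-1 * b n)) @[n --> \oo] --> 0.
  rewrite -[X in _ --> X](mulr0 2); apply: cvgMr.
  have b_y : 2^-1 * b n @[n --> \oo] --> +oo.
    apply/cvgryPge => A; near=> n; rewrite -ler_pdivrMl// invrK.
    rewrite (@le_trans _ _ n%:R)//; last by rewrite /b ler_nat ltnW.
    by near: n; exact: nbhs_infty_ger.
  exact: (@cvg_comp _ _ _ (fun n => 2^-1 * b n) (fun x => expR (- x)) _ _ _ b_y (@cvgr_expR R)).
apply: (squeeze_cvgr _ (cvg_cst 0) b0); apply: nearW => n; rewrite G_ge0/=.
by rewrite -mulNr G_le.
Unshelve. all: by end_near. Qed.

(** In [G_FTC] let the segments exhaust the half-line: the boundary terms vanish and the integral of
    [G q] has a finite limit, hence so does that of [G (q - 1)]. *)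
Lemma GammaFD1 (q : R) : 0 < q <= 1 -> GammaF (q + 1) = q * GammaF q.
Proof.
move=> /andP[q0 q1].
have q01 : 0 <= q <= 1 by rewrite ltW.
rewrite /GammaF addrK -/(G _).
have fJ : (\int[mu]_(s in `]0%R, +oo[) (G q s)%:E)%E \is a fin_num.
  by apply: integrable_fin_num => //; exact: integrable_G.
have cI : \int[mu]_(s in `[a n, b n]) G q s @[n --> \oo] --> 
    \int[mu]_(s in `]0, +oo[) G q s.
  by apply: fine_cvg; rewrite fineK//; exact: G_cvg.
set J := (X in _ --> X) in cI.
have cI1 : \int[mu]_(s in `[a n, b n]) G (q - 1) s @[n --> \oo] --> J / q.
  have E n : \int[mu]_(s in `[a n, b n]) G (q - 1) s =
      (\int[mu]_(s in `[a n, b n]) G q s + (G q (b n) - G q (a n))) / q.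
    rewrite -(G_FTC q (a n) (b n))// addrCA subrr addr0 mulrAC divff ?mul1r//.
    by rewrite gt_eqF.
  rewrite (funext E) -[X in _ --> X / q]addr0 -[X in _ --> (_ + X) / q](subr0 0).
  apply: cvgMl; apply: cvgD => //; apply: cvgB; [exact: G_cvg0_left|exact: G_cvg0_right].
have cG1 n : {within `[a n, b n], continuous (G (q - 1))}.
  apply: derivable_within_continuous => s; rewrite in_itv/= => /andP[as_ _].
  apply: derivableM; last exact: ex_derive.
  by apply: ex_derive; apply: is_derive1_powR; exact: lt_le_trans as_.
have fI1 n : (\int[mu]_(s in `[a n, b n]) (G (q - 1) s)%:E)%E \is a fin_num.
  apply: integrable_fin_num => //.
  by apply: continuous_segment_integrable; exact: cG1.
(* Lifted to the extended reals, this limit can be identified with that of [G_cvg], so the integral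
   of [G (q - 1)] over the half-line is finite. *)
have cE1 : (\int[mu]_(s in `[a n, b n]) (G (q - 1) s)%:E)%E @[n --> \oo] -->
    (J / q)%:E.
  have E n : (\int[mu]_(s in `[a n, b n]) (G (q - 1) s)%:E =
      (\int[mu]_(s in `[a n, b n]) G (q - 1) s)%:E)%E.
    by rewrite /Rintegral fineK//; exact: fI1.
  by rewrite (funext E); apply: cvg_EFin => //; exact: nearW.
have -> : \int[mu]_(s in `]0, +oo[) G (q - 1) s = J / q.
  by rewrite /Rintegral (cvg_unique _ (G_cvg (q - 1)) cE1).
by rewrite mulrCA divff ?mulr1// gt_eqF.
Qed.

(** On [[1, 2]] the integrand is at least [e^(-2)]. The bound [q <= 2] gives access to
    [integrable_G]; finiteness matters because [Rintegral] sends an infinite integral to 0. *)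
Let GammaF_gt0_ge1 (q : R) : 1 <= q <= 2 -> 0 < GammaF q.
Proof.
move=> /andP[q1 q2].
have q01 : 0 <= q - 1 <= 1 by lra.
rewrite /GammaF -/(G _).
have iJ := integrable_G _ q01.
have s12 (s : R) : `[1%R, 2%R]%classic s -> `]0%R, +oo[%classic s.
  by rewrite /= !in_itv/= andbT => /andP[+ _]; exact: lt_le_trans.
have cG12 : {within `[1, 2], continuous (G (q - 1))}.
  apply: derivable_within_continuous => s; rewrite in_itv/= => /andP[s1 _].
  apply: derivableM; last exact: ex_derive.
  by apply: ex_derive; apply: is_derive1_powR; exact: lt_le_trans s1.
have iG12 : mu.-integrable `[1%R, 2%R] (EFin \o G (q - 1)).
  by apply: continuous_segment_integrable; apply: cG12.
have : (\int[mu]_(s in `[1%R, 2%R]) (G (q - 1) s)%:E <=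
    \int[mu]_(s in `]0%R, +oo[) (G (q - 1) s)%:E)%E.
  apply: ge0_subset_integral => //.
  - by apply/measurable_EFinP; exact: measurable_funTS (measurable_G _).
  - by move=> s _; rewrite lee_fin.
rewrite -[X in (X <= _)%E -> _]fineK; last exact: integrable_fin_num.
rewrite -[X in (_ <= X)%E -> _]fineK; last exact: integrable_fin_num.
rewrite lee_fin.
apply: lt_le_trans; apply: (@lt_le_trans _ _ (expR (- 2))); first exact: expR_gt0.
have -> : expR (- 2) = \int[mu]_(s in `[1, 2]) (expR (- 2) + 0 * (s - 0) + 0 * (s - 0) ^+ 2).
  by rewrite Rintegral_quadratic ?ltr1n//; field.
apply: le_Rintegral => //=; first exact: integrable_quadratic.
move=> s /=; rewrite in_itv/= => /andP[s1 s2].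
rewrite !mul0r !addr0 -[leLHS]mul1r; apply: ler_pM => //.
  by rewrite -[leLHS](powRr0 s) ler_powR//; lra.
by rewrite ler_expR lerN2.
Qed.

Lemma GammaF_gt0 (q : R) : 0 < q <= 2 -> 0 < GammaF q.
Proof.
move=> /andP[q0 q2]; have [q1|q1] := ltP q 1; last by rewrite GammaF_gt0_ge1 ?q1.
have : 0 < GammaF (q + 1) by apply: GammaF_gt0_ge1; lra.
by rewrite GammaFD1 ?pmulr_rgt0 ?q0 ?ltW.
Qed.

End Gamma.

(** * Discrete Caputo kernel *)

Section Slopes.
Context {R : realType}.
Notation mu := (@lebesgue_measure R).
(** An abstract kernel [w], increasing and convex to the left of its singularity [y]; [d] plays the
    role of its derivative. *)
Variables (w d : R -> R) (y : R).
Hypothesis cw : forall a b, b < y -> {within `[a, b], continuous w}.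
Hypothesis d_ge0 : forall a, a < y -> 0 <= d a.
Hypothesis d_mono : forall a b, a <= b -> b < y -> d a <= d b.
Hypothesis slope : forall a b, a <= b -> b < y ->
  d a * (b - a) <= w b - w a <= d b * (b - a).

(** Subtracting the midpoint value [w q] from [w] does not change the moment, and then both factors
    of the integrand have the same sign. *)
Lemma moment_ge0 (a b : R) : a < b -> b < y ->
  0 <= \int[mu]_(s in `[a, b]) ((s - (b + a) / 2) * w s).
Proof.
move=> ab by_; set q := (b + a) / 2.
have <- : \int[mu]_(s in `[a, b]) (0 + w q * (s - q) + 0 * (s - q) ^+ 2) = 0.
  by rewrite Rintegral_quadratic// /q; field.
apply: le_Rintegral => //=.
- exact: integrable_quadratic.
- by apply: continuous_segment_integrable; apply: within_continuous_mul_sub; exact: cw.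
move=> s /=; rewrite in_itv/= => /andP[as_ sb].
have qy : q < y by rewrite /q; lra.
rewrite -subr_ge0 [leRHS](_ : _ = (s - q) * (w s - w q)); last by ring.
have [qs|sq] := leP q s.
  have /andP[ws _] := slope q s qs (le_lt_trans sb by_).
  have wd := d_ge0 q qy.
  by rewrite mulr_ge0 ?subr_ge0// -subr_ge0 (le_trans _ ws)// mulr_ge0 ?subr_ge0.
have /andP[ws _] := slope s q (ltW sq) qy.
have wd := d_ge0 s (le_lt_trans sb by_).
rewrite -mulrNN mulr_ge0// oppr_ge0 subr_le0 ?(ltW sq)//.
by rewrite -subr_ge0 (le_trans _ ws)// mulr_ge0 ?subr_ge0// ltW.
Qed.

(** The right-hand side averages [w] against the weight [1 - k (s - q)], which is nonnegative with
    mean 1, and [w] is at least [w a]. *)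
Lemma left_value_le_mean_sub_moment (a b c : R) : a < b -> b < y -> 0 <= c ->
  w a <= (b - a)^-1 * \int[mu]_(s in `[a, b]) w s
    - 2 / ((b - a) * ((b - a) + c))
      * \int[mu]_(s in `[a, b]) ((s - (b + a) / 2) * w s).
Proof.
move=> ab by_ c0; set q := (b + a) / 2; set k := 2 / (b - a + c).
have ba : 0 < b - a by rewrite subr_gt0.
have bac : 0 < b - a + c by rewrite ltr_wpDr.
have iw : mu.-integrable `[a, b] (EFin \o w).
  by apply: continuous_segment_integrable; exact: cw.
have ciw := within_continuous_mul_sub w a b q (cw a b by_).
have iqw := continuous_segment_integrable _ a b ciw.
have ikqw : mu.-integrable `[a, b] (EFin \o (fun s => k * ((s - q) * w s))).
  apply: continuous_segment_integrable => x.
  by apply: cvgM; [exact: cvg_cst|exact: ciw].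
have : \int[mu]_(s in `[a, b]) (w a + - (k * w a) * (s - q) + 0 * (s - q) ^+ 2)
    <= \int[mu]_(s in `[a, b]) (w s - k * ((s - q) * w s)).
  apply: le_Rintegral => //=.
  - exact: integrable_quadratic.
  - have := integrableB _ iw ikqw; exact.
  move=> s /=; rewrite in_itv/= => /andP[as_ sb].
  rewrite -subr_ge0 [leRHS](_ : _ = (1 - k * (s - q)) * (w s - w a)); last by ring.
  have /andP[ws _] := slope a s as_ (le_lt_trans sb by_).
  have wd := d_ge0 a (lt_trans ab by_).
  apply: mulr_ge0; last by rewrite (le_trans _ ws)// mulr_ge0 ?subr_ge0.
  (* Since [s - q <= (b - a) / 2], one has [k (s - q) <= (b - a) / (b - a + c) <= 1]. *)
  rewrite /k /q subr_ge0 mulrAC ler_pdivrMr// mul1r; lra.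
rewrite RintegralB// RintegralZl// Rintegral_quadratic//.
rewrite -(ler_pM2l (_ : 0 < (b - a)^-1)) ?invr_gt0//.
rewrite [leLHS](_ : _ = w a); last by rewrite /k /q; field; rewrite !gt_eqF.
move=> /le_trans; apply.
by rewrite mulrBr mulrA (_ : _^-1 * k = 2 / ((b - a) * (b - a + c)))// /k; field; rewrite !gt_eqF.
Qed.

(** The kernel lies below the line of slope [d a] that meets it at [b]. The deficit kept here later
    absorbs a moment. *)
Lemma integral_le_right_value (a b : R) : a < b -> b < y ->
  \int[mu]_(s in `[a, b]) w s <= (b - a) * w b - d a * (b - a) ^+ 2 / 2.
Proof.
move=> ab by_.
have -> : (b - a) * w b - d a * (b - a) ^+ 2 / 2 =
    \int[mu]_(s in `[a, b]) (w b + d a * (s - b) + 0 * (s - b) ^+ 2).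
  by rewrite Rintegral_quadratic//; field.
apply: le_Rintegral => //=.
- by apply: continuous_segment_integrable; exact: cw.
- exact: integrable_quadratic.
move=> s /=; rewrite in_itv/= => /andP[as_ sb].
have sy := le_lt_trans sb by_.
have /andP[ws _] := slope s b sb by_.
have das := d_mono a s as_ sy.
have : d a * (b - s) <= d s * (b - s) by rewrite ler_wpM2r ?subr_ge0.
by lra.
Qed.

(** After centring at the midpoint, [(s - q) (w s - w q) <= d b (s - q)^2] on both sides of [q]. *)
Lemma moment_le (a b : R) : a < b -> b < y ->
  \int[mu]_(s in `[a, b]) ((s - (b + a) / 2) * w s) <= d b * (b - a) ^+ 3 / 12.
Proof.
move=> ab by_; set q := (b + a) / 2.
have -> : d b * (b - a) ^+ 3 / 12 =
    \int[mu]_(s in `[a, b]) (0 + w q * (s - q) + d b * (s - q) ^+ 2).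
  by rewrite Rintegral_quadratic// /q; field.
apply: le_Rintegral => //=.
- by apply: continuous_segment_integrable; apply: within_continuous_mul_sub; exact: cw.
- exact: integrable_quadratic.
move=> s /=; rewrite in_itv/= => /andP[as_ sb].
have qb : q <= b by rewrite /q; lra.
have qy : q < y := le_lt_trans qb by_.
have sy := le_lt_trans sb by_.
rewrite add0r -subr_ge0.
rewrite [leRHS](_ : _ = (s - q) * (d b * (s - q) - (w s - w q))); last by ring.
have [qs|sq] := leP q s.
  rewrite mulr_ge0 ?subr_ge0//.
  have /andP[_ /le_trans] := slope q s qs sy; apply.
  by rewrite ler_wpM2r ?subr_ge0// d_mono.
rewrite -mulrNN mulr_ge0// ?oppr_ge0 ?subr_le0 ?(ltW sq)//.
have /andP[_ ws] := slope s q (ltW sq) qy.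
have : d q * (q - s) <= d b * (q - s).
  by rewrite ler_wpM2r ?subr_ge0 ?(ltW sq)// d_mono.
by lra.
Qed.
(** The deficit of the mean on [[b, c]] and the bound for the moment on [[a, b]] both carry the
    slope [d b] at the common node, so only the step ratio decides. *)
Lemma mean_add_moment_le (a b c : R) :
  a < b -> b < c -> c < y -> 4 / 7 <= (c - b) / (b - a) ->
  (c - b)^-1 * \int[mu]_(s in `[b, c]) w s
    + 2 / ((b - a) * (b - a + (c - b)))
      * \int[mu]_(s in `[a, b]) ((s - (b + a) / 2) * w s) / ((c - b) / (b - a))
  <= w c.
Proof.
move=> ab bc cy; set r := (c - b) / (b - a) => r47.
have ba : 0 < b - a by rewrite subr_gt0.
have cb : 0 < c - b by rewrite subr_gt0.
have r0 : 0 < r by rewrite divr_gt0.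
have cbE : c - b = r * (b - a) by rewrite /r divfK// gt_eqF.
have by_ := lt_trans bc cy.
have I1 := integral_le_right_value b c bc cy.
have I2 := moment_le a b ab by_.
have db := d_ge0 b by_.
rewrite -subr_ge0.
set X := \int[mu]_(s in _) _ in I1 *; set Y := \int[mu]_(s in _) _ in I2 *.
rewrite cbE in I1 *; set t := b - a in ba I1 I2 *; clearbody t r X Y.
have J1 : (r * t)^-1 * X <= w c - d b * (r * t) / 2.
  rewrite [leLHS]mulrC ler_pdivrMr ?mulr_gt0//; apply: le_trans I1 _.
  by rewrite le_eqVlt; apply/orP; left; apply/eqP; ring.
have J2 : 2 / (t * (t + r * t)) * Y / r <= d b * t / (6 * (1 + r) * r).
  have E : d b * t / (6 * (1 + r) * r) = 2 / (t * (t + r * t)) * (d b * t ^+ 3 / 12) / r.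
    by field; rewrite !gt_eqF// addr_gt0// mulr_gt0.
  rewrite E ler_pM2r ?invr_gt0// ler_pM2l// divr_gt0// mulr_gt0// addr_gt0 ?mulr_gt0//.
have J3 : d b * t / (6 * (1 + r) * r) <= d b * (r * t) / 2.
  rewrite ler_pdivrMr ?mulr_gt0 ?addr_gt0//.
  rewrite -subr_ge0 (_ : _ - _ = d b * t * (3 * r ^+ 2 * (1 + r) - 1)); last by field.
  apply: mulr_ge0; first by rewrite mulr_ge0 ?(ltW ba).
  (* The quantity [3 r^2 (1 + r)] increases with [r] and equals 528/343 > 1 at [r = 4/7]. *)
  have : (4 / 7) ^+ 2 * (11 / 7) <= r ^+ 2 * (1 + r).
    rewrite ler_pM ?sqr_ge0//; last by lra.
    by rewrite ler_pXn2r// nnegrE ltW.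
  by lra.
lra.
Qed.

End Slopes.

(** * Bounds and monotonicity of the weights *)

Section Kernel.
Context {R : realType}.
Notation mu := (@lebesgue_measure R).

Lemma tgridD (tau : nat -> R) (k : nat) :
  tgrid tau k.+1 = tgrid tau k + tau k.+1.
Proof. by rewrite /tgrid big_nat_recr. Qed.

Variables (alpha : R) (tau : nat -> R) (N : nat).
Hypothesis alpha01 : 0 < alpha < 1.
Hypothesis tau_gt0 : forall k, (1 <= k <= N)%N -> 0 < tau k.

Let sg : R := alpha / 2.

Lemma tgrid_le (j k : nat) : (j <= k)%N -> (k <= N)%N -> tgrid tau j <= tgrid tau k.
Proof.
elim: k => [|k IH]; first by rewrite leqn0 => /eqP ->.
rewrite leq_eqVlt => /predU1P[->//|]; rewrite ltnS => jk kN.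
by rewrite tgridD (le_trans (IH jk (ltnW kN)))// lerDl ltW// tau_gt0.
Qed.

Lemma tshift_sub (n : nat) : (0 < n)%N ->
  tshift tau sg n - tgrid tau n.-1 = (1 - sg) * tau n.
Proof. by case: n => // n _; rewrite /tshift tgridD/=; ring. Qed.

(** The singularity lies beyond every earlier node, so the kernel is smooth on all cells but the
    last. *)
Lemma tgrid_lt_tshift (n k : nat) : (k < n <= N)%N -> tgrid tau k < tshift tau sg n.
Proof.
move=> /andP[kn nN]; have n0 : (0 < n)%N by case: n kn {nN}.
apply: (@le_lt_trans _ _ (tgrid tau n.-1)).
  by apply: tgrid_le; [rewrite -ltnS prednK|exact: leq_trans (leq_pred n) nN].
rewrite -subr_gt0 tshift_sub// mulr_gt0 ?tau_gt0 ?n0//.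
by move: alpha01; rewrite /sg; lra.
Qed.

Let gam_gt0 : 0 < GammaF (1 - alpha).
Proof. by apply: GammaF_gt0; move: alpha01; lra. Qed.

Section Omega.
Variable y : R.
Let w s := omega (1 - alpha) (y - s).
Let d s := alpha * powR (y - s) (- alpha - 1) / GammaF (1 - alpha).

Lemma is_derive_omega x : x < y -> is_derive x 1 w (d x).
Proof.
move=> xy; have dP := is_derive_powR_sub y (- alpha) x xy.
have -> : w = fun s => powR (y - s) (- alpha) / GammaF (1 - alpha).
  by apply/funext => s; rewrite /w /omega addrAC subrr add0r.
by apply: is_derive_eq; rewrite /d /GRing.scale/= opprK mulr0; ring.
Qed.

Lemma omega_continuous a b : b < y -> {within `[a, b], continuous w}.
Proof.
move=> by_; apply: derivable_within_continuous => x.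
rewrite in_itv/= => /andP[_ xb].
by have := is_derive_omega _ (le_lt_trans xb by_) => dx; exact: ex_derive.
Qed.

Lemma omega_slope_ge0 a : a < y -> 0 <= d a.
Proof.
move=> ay; rewrite /d divr_ge0 ?mulr_ge0 ?powR_ge0//; last exact: ltW.
by move: alpha01; lra.
Qed.

Lemma omega_slope_mono a b : a <= b -> b < y -> d a <= d b.
Proof.
move=> ab by_; have [a0 a1] := andP alpha01.
rewrite /d ler_pM2r ?invr_gt0// ler_pM2l//.
rewrite -opprD !powRN lef_pV2 ?posrE ?powR_gt0 ?subr_gt0//; last exact: le_lt_trans by_.
by apply: ge0_ler_powR; rewrite ?nnegrE; lra.
Qed.

(** Mean value theorem, with an increasing derivative; this supplies the [slope] hypothesis of the
    abstract kernel. *)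
Lemma omega_slope a b : a <= b -> b < y ->
  d a * (b - a) <= w b - w a <= d b * (b - a).
Proof.
move=> ab by_.
have dw x : x \in `]a, b[%R -> is_derive x 1 w (d x).
  rewrite in_itv/= => /andP[_ xb].
  by apply: is_derive_omega; exact: lt_trans by_.
have [c] := MVT_segment ab dw (omega_continuous a b by_).
rewrite in_itv/= => /andP[ac cb] ->.
have cy := le_lt_trans cb by_.
by apply/andP; split; rewrite ler_wpM2r ?subr_ge0// omega_slope_mono.
Qed.

Lemma omega_ge0 s : 0 <= w s.
Proof. by rewrite /w /omega divr_ge0 ?powR_ge0// ltW. Qed.

End Omega.
Let w n (s : R) : R := omega (1 - alpha) (tshift tau sg n - s).

Let tgrid_step k : (1 <= k)%N -> tgrid tau k - tgrid tau k.-1 = tau k.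
Proof. by case: k => // k _; rewrite tgridD addrAC subrr add0r. Qed.

Let tgrid_lt k : (1 <= k <= N)%N -> tgrid tau k.-1 < tgrid tau k.
Proof. by move=> kN; rewrite -subr_gt0 tgrid_step ?tau_gt0//; case/andP: kN. Qed.

Lemma acoef_regular n k : (1 <= k < n)%N -> (n <= N)%N ->
  acoef tau alpha n k =
  (tau k)^-1 * \int[mu]_(s in `[tgrid tau k.-1, tgrid tau k]) w n s.
Proof.
move=> /andP[k1 kn] nN; rewrite /acoef min_l//.
by apply/ltW/tgrid_lt_tshift; rewrite ?kn.
Qed.

(** On the last cell the integral stops at the singularity and is an explicit power; its factor
    [1 / (1 - alpha)] turns [GammaF (1 - alpha)] into [GammaF (2 - alpha)]. *)
Lemma acoef_last n : (1 <= n <= N)%N ->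
  acoef tau alpha n n =
  powR (1 - sg) (1 - alpha) * powR (tau n) (- alpha) / GammaF (2 - alpha).
Proof.
move=> /andP[n1 nN].
have sg1 : 0 < 1 - sg by move: alpha01; rewrite /sg; lra.
have a1 : 0 < 1 - alpha by move: alpha01; lra.
have tn : 0 < tau n by rewrite tau_gt0// n1.
have lt_y : tgrid tau n.-1 < tshift tau sg n.
  by apply: tgrid_lt_tshift; rewrite ?prednK ?leqnn.
rewrite /acoef -/sg min_r; last first.
  rewrite -subr_ge0 (_ : _ - _ = tgrid tau n - tgrid tau n.-1 - (tshift tau sg n - tgrid tau n.-1)); last by ring.
  rewrite tshift_sub// tgrid_step// -[X in X - _]mul1r -mulrBl mulr_ge0 ?(ltW tn)//.
  by move: alpha01; rewrite /sg; lra.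
have I := integral_powR_sub (tgrid tau n.-1) (tshift tau sg n) (- alpha) lt_y _.
have -> : (fun s => omega (1 - alpha) (tshift tau sg n - s)) =
    fun s => (GammaF (1 - alpha))^-1 * powR (tshift tau sg n - s) (- alpha).
  by apply/funext => s; rewrite /omega mulrC; congr (_ * powR _ _); ring.
(* The integrand is nonnegative, so the finite value in [I] gives integrability. *)
rewrite RintegralZl//; last first.
  apply/integrableP; split.
    apply/measurable_EFinP; apply: measurable_funTS.
    by apply: (measurableT_comp (@measurable_powR R _)); exact: measurable_funB.
  under eq_integral do rewrite /= ger0_norm ?powR_ge0//.
  by rewrite I ?ltry//; move: alpha01; lra.
rewrite /Rintegral I/=; last by move: alpha01; lra.
rewrite tshift_sub// (addrC (- alpha)) (_ : 2 - alpha = 1 - alpha + 1); last by ring.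
rewrite GammaFD1; last by move: alpha01; lra.
rewrite powRM ?(ltW sg1) ?(ltW tn)// [powR (tau n) _]powRD ?gt_eqF ?implybT// powRr1 ?(ltW tn)//.
by field; rewrite !gt_eqF.
Qed.

Lemma bcoef_ge0 n k : (1 <= k < n)%N -> (n <= N)%N -> 0 <= bcoef tau alpha n k.
Proof.
move=> /andP[k1 kn] nN.
have tk : 0 < tau k by rewrite tau_gt0// k1 ltnW// (leq_trans kn).
have tk1 : 0 < tau k.+1 by rewrite tau_gt0//= (leq_trans kn).
have lt_y : tgrid tau k < tshift tau sg n.
  by apply: tgrid_lt_tshift; rewrite ?kn.
rewrite /bcoef mulr_ge0//; first by rewrite divr_ge0// mulr_ge0 ?addr_ge0// ltW.
apply: (@moment_ge0 _ (w n) _ (tshift tau sg n) (omega_continuous _)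
  (omega_slope_ge0 _) (omega_slope _)) => //.
by apply: tgrid_lt; rewrite k1 ltnW// (leq_trans kn).
Qed.

Lemma omega_le_acoef_sub_bcoef n k : (1 <= k < n)%N -> (n <= N)%N ->
  w n (tgrid tau k.-1) <= acoef tau alpha n k - bcoef tau alpha n k.
Proof.
move=> /andP[k1 kn] nN.
have tk1 : 0 < tau k.+1 by rewrite tau_gt0//= (leq_trans kn).
have lt_y : tgrid tau k < tshift tau sg n.
  by apply: tgrid_lt_tshift; rewrite ?kn.
have lt_k : tgrid tau k.-1 < tgrid tau k.
  by apply: tgrid_lt; rewrite k1 ltnW// (leq_trans kn).
have := @left_value_le_mean_sub_moment _ (w n) _ (tshift tau sg n) (omega_continuous _)
  (omega_slope_ge0 _) (omega_slope _)
  _ _ (tau k.+1) lt_k lt_y (ltW tk1).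
by rewrite tgrid_step// acoef_regular// k1.
Qed.

Hypothesis ratio_ge : forall k, (2 <= k <= N)%N -> 4 / 7 <= step_ratio tau k.

(** [mean_add_moment_le] on the cells ending at [t_{k-1}] and [t_k]; two cells are involved, hence
    [2 <= k]. *)
Lemma acoef_add_bcoef_le_omega n k : (2 <= k < n)%N -> (n <= N)%N ->
  acoef tau alpha n k + bcoef tau alpha n k.-1 / step_ratio tau k
  <= w n (tgrid tau k).
Proof.
case: k => [|[|k]]// /andP[_ kn] nN.
have kN : (k.+2 <= N)%N by rewrite ltnW// (leq_trans kn).
have lt_y : tgrid tau k.+2 < tshift tau sg n.
  by apply: tgrid_lt_tshift; rewrite ?kn.
have lt_1 : tgrid tau k < tgrid tau k.+1 by apply: (tgrid_lt k.+1); rewrite /= ltnW.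
have lt_2 : tgrid tau k.+1 < tgrid tau k.+2 by apply: (tgrid_lt k.+2).
have := @mean_add_moment_le _ (w n) _ (tshift tau sg n)
  (omega_continuous _) (omega_slope_ge0 _) (omega_slope_mono _) (omega_slope _)
  (tgrid tau k) (tgrid tau k.+1) (tgrid tau k.+2) lt_1 lt_2 lt_y.
rewrite (tgrid_step k.+1)// (tgrid_step k.+2)//.
by move=> /(_ (ratio_ge k.+2 kN)); rewrite acoef_regular.
Qed.

Lemma acoef_le_omega n k : (1 <= k < n)%N -> (n <= N)%N ->
  acoef tau alpha n k <= w n (tgrid tau k).
Proof.
move=> /andP[k1 kn] nN.
have kN : (k <= N)%N by rewrite ltnW// (leq_trans kn).
have lt_y : tgrid tau k < tshift tau sg n.
  by apply: tgrid_lt_tshift; rewrite ?kn.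
have lt_k : tgrid tau k.-1 < tgrid tau k by apply: tgrid_lt; rewrite k1.
have := @integral_le_right_value _ (w n) _ (tshift tau sg n) (omega_continuous _)
  (omega_slope_mono _) (omega_slope _) _ _ lt_k lt_y.
have tk : 0 < tau k by rewrite tau_gt0// k1.
rewrite acoef_regular ?k1// tgrid_step// => I.
rewrite [leLHS]mulrC ler_pdivrMr//; apply: le_trans I _.
rewrite [leRHS]mulrC gerBl divr_ge0// mulr_ge0 ?sqr_ge0//.
by apply: omega_slope_ge0 => //; exact: lt_trans lt_k lt_y.
Qed.

(** The subtracted moment is nonnegative and may be dropped; at [k = 1] there is no preceding cell
    to contribute one. *)
Lemma Bcoef_le_omega n k : (1 <= k < n)%N -> (n <= N)%N ->
  Bcoef tau alpha n k <= w n (tgrid tau k).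
Proof.
move=> /andP[k1 kn] nN; have b0 := bcoef_ge0 n k.
rewrite k1 kn in b0; have {}b0 := b0 isT nN.
rewrite /Bcoef (gtn_eqF (leq_ltn_trans k1 kn)) (ltn_eqF kn).
have [kE|kN1] := eqVneq k 1%N.
  by rewrite kE in kn b0 *; have /= := acoef_le_omega n 1 kn nN; lra.
have k2n : (2 <= k < n)%N by rewrite kn andbT ltn_neqAle eq_sym kN1.
by have /= := acoef_add_bcoef_le_omega n k k2n nN; lra.
Qed.

Lemma omega_le_Bcoef n k : (1 <= k < n)%N -> (n <= N)%N ->
  w n (tgrid tau k.-1) <= Bcoef tau alpha n k.
Proof.
move=> /andP[k1 kn] nN; have := omega_le_acoef_sub_bcoef n k; rewrite k1 kn => /(_ isT nN) L.
rewrite /Bcoef (gtn_eqF (leq_ltn_trans k1 kn)) (ltn_eqF kn).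
have [kE|kN1] := eqVneq k 1%N; first by rewrite kE in L *.
suff : 0 <= bcoef tau alpha n k.-1 / step_ratio tau k by lra.
have k2 : (2 <= k)%N by rewrite ltn_neqAle eq_sym kN1.
have kN : (k <= N)%N by rewrite ltnW// (leq_trans kn).
apply: divr_ge0; last by have := ratio_ge k; rewrite k2 kN => /(_ isT); lra.
apply: bcoef_ge0 => //; apply/andP; split; last exact: leq_ltn_trans (leq_pred k) kn.
by rewrite -ltnS prednK.
Qed.

(** The kernel value at [t_k] separates consecutive weights. Here [k] counts from the oldest level,
    so weights grow towards the present. *)
Lemma Bcoef_le n k : (1 <= k)%N -> (k.+1 < n <= N)%N ->
  Bcoef tau alpha n k <= Bcoef tau alpha n k.+1.
Proof.
move=> k1 /andP[kn nN].
apply: (le_trans (Bcoef_le_omega n k _ nN)); first by rewrite k1 ltnW.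
by apply: (omega_le_Bcoef n k.+1); rewrite ?kn.
Qed.

Lemma Bcoef_first_ge0 n : (1 < n <= N)%N -> 0 <= Bcoef tau alpha n 1.
Proof.
move=> /andP[n1 nN]; apply: le_trans (omega_le_Bcoef n 1 _ nN) => //.
exact: omega_ge0.
Qed.

Lemma acoef_le_Bcoef_last n : (1 <= n <= N)%N ->
  acoef tau alpha n n <= Bcoef tau alpha n n.
Proof.
case: n => [|[|n]]// nN; rewrite /Bcoef/= eqxx lerDl divr_ge0//.
  by apply: bcoef_ge0 => //=; rewrite ltnSn.
by have := ratio_ge n.+2; rewrite nN => /(_ isT); lra.
Qed.

(** Compares with the last weight, which [Bcoef_le] leaves out: the kernel at [t_{n-1}] and
    [acoef tau alpha n n] are explicit powers with this quotient. *)
Lemma Bcoef_prelast_le n : (1 < n <= N)%N ->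
  Bcoef tau alpha n n.-1 <= (1 - alpha) / (1 - sg) * Bcoef tau alpha n n.
Proof.
move=> /andP[n1 nN]; have n0 := ltnW n1.
have sg1 : 0 < 1 - sg by move: alpha01; rewrite /sg; lra.
have a1 : 0 < 1 - alpha by move: alpha01; lra.
have tn : 0 < tau n by rewrite tau_gt0// n0.
apply: (le_trans (Bcoef_le_omega n n.-1 _ nN)).
  by case: (n) n1 => [|[|k]]//= _; rewrite ltnSn.
apply: (@le_trans _ _ ((1 - alpha) / (1 - sg) * acoef tau alpha n n)); last first.
  by rewrite ler_pM2l ?divr_gt0// acoef_le_Bcoef_last// n0.
rewrite acoef_last ?n0// (_ : 2 - alpha = 1 - alpha + 1); last by ring.
rewrite GammaFD1; last by move: alpha01; lra.
rewrite /w tshift_sub// /omega powRM ?(ltW sg1) ?(ltW tn)//.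
rewrite (_ : 1 - alpha - 1 = - alpha); last by ring.
rewrite powRD ?gt_eqF ?implybT// powRr1 ?(ltW sg1)// le_eqVlt; apply/orP; left; apply/eqP.
by field; rewrite !gt_eqF.
Qed.

End Kernel.

(** * Maximum principle *)

Section MaxPrinciple.
Context {R : realType}.

(** Nonnegativity of [c] accounts for the default value 0 of the maxima. *)
Lemma normInfP (M : nat) (v : grid R M) (c : R) : 0 <= c ->
  (forall i j, - c <= v i j <= c) <-> normInf v <= c.
Proof.
move=> c0; rewrite /normInf; split.
  move=> vc; apply/bigmax_leP; split=> // i _; apply/bigmax_leP; split=> // j _.
  by rewrite ler_norml.
by move=> /bigmax_leP[_ vc] i j; have /bigmax_leP[_ /(_ j isT)] := vc i isT; rewrite ler_norml.
Qed.

(** Each of the four neighbours is at most [c]. Taking [c] as the maximum yields the sign of the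
    Laplacian there; [c = beta] controls the explicit diffusion. *)
Lemma lap_h_le (M : nat) (h c : R) (v : grid R M) i j :
  (forall i j, v i j <= c) -> lap_h h v i j <= 4 / h ^+ 2 * (c - v i j).
Proof.
move=> vc; rewrite (_ : _ * _ = h ^- 2 * (4 * (c - v i j))); last by ring.
rewrite /lap_h ler_wpM2l ?invr_ge0 ?sqr_ge0//.
have := vc (ordS i) j; have := vc (ord_pred i) j.
by have := vc i (ordS j); have := vc i (ord_pred j); lra.
Qed.

Lemma lap_hN (M : nat) (h : R) (v : grid R M) i j :
  lap_h h (fun i j => - v i j) i j = - lap_h h v i j.
Proof. by rewrite /lap_h; ring. Qed.

Lemma lap_h_lin (M : nat) (h a b : R) (v w : grid R M) i j :
  lap_h h (fun i j => a * v i j + b * w i j) i j = a * lap_h h v i j + b * lap_h h w i j.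
Proof. by rewrite /lap_h; ring. Qed.

(** At a maximum point the Laplacian is nonpositive, so the hypothesis there leaves
    [c * v <= c * b]. *)
Lemma discrete_max_principle (M : nat) (h a c b : R) (v : grid R M) :
  0 <= a -> 0 < c ->
  (forall i j, c * v i j <= a * lap_h h v i j + c * b) ->
  forall i j, v i j <= b.
Proof.
move=> a0 c0 H i j.
case: (@arg_maxP _ R ('I_M * 'I_M)%type (i, j) xpredT (fun x => v x.1 x.2) isT) => -[k l] _ vmax.
apply: (le_trans (vmax (i, j) isT)) => /=.
rewrite -(ler_pM2l c0); apply: (le_trans (H k l)); rewrite gerDr.
rewrite mulr_ge0_le0//; apply: le_trans (lap_h_le M h (v k l) v k l _) _.
  by move=> i' j'; exact: (vmax (i', j') isT).
by rewrite subrr mulr0.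
Qed.

(* Summation by parts turns the history term into a combination of past values
   with nonnegative weights. *)
Lemma history_le (B v : nat -> R) (c : R) (n : nat) :
  0 <= c ->
  (0 < n)%N -> 0 <= B 1%N -> (forall k, (1 <= k)%N -> (k < n)%N -> B k <= B k.+1) ->
  (forall k, (k <= n)%N -> v k <= c) ->
  B n * v n - \sum_(1 <= k < n.+1) B k * (v k - v k.-1) <= B n * c.
Proof.
move=> c0; case: n => // n _ B1; elim: n => [|n IH] Bm vc.
  by rewrite big_nat1/= mulrBr opprB addrCA subrr addr0 ler_wpM2l// vc.
rewrite big_nat_recr//=.
have IH' := IH (fun k k1 kn => Bm k k1 (ltnW kn)) (fun k kn => vc k (leqW kn)).
have BB : 0 <= B n.+2 - B n.+1 by rewrite subr_ge0 Bm.
have := ler_wpM2l BB (vc n.+1 (leqnSn _)); lra.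
Qed.

(** Oddness lets the lower bound follow from the upper one. For Flory-Huggins, reflection inverts
    the quotient in the logarithm. *)
Lemma fpot_odd (p : potential R) (beta : R) : potential_ok p beta ->
  forall x, - beta <= x <= beta -> fpot p (- x) = - fpot p x.
Proof.
case: p => [|th thc] /=; first by move=> _ x _; ring.
move=> [_ [_ [b0 [b1 _]]]] x /andP[xb bx].
have xm : 0 < 1 - x by lra.
have xp : 0 < 1 + x by lra.
rewrite opprK -[X in ln X]invrK invf_div lnV ?posrE ?divr_gt0//; ring.
Qed.

Lemma fpot_derivable (p : potential R) (beta : R) : potential_ok p beta ->
  forall x, - beta <= x <= beta -> derivable (fpot p) x 1.
Proof.
case: p => [|th thc] /=; first by move=> _ x _; exact: ex_derive.
move=> [_ [_ [b0 [b1 _]]]] x /andP[xb bx].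
have xm : 0 < 1 - x by lra.
have xp : 0 < 1 + x by lra.
have xp0 : 1 + x != 0 by rewrite gt_eqF.
have dq : derivable (fun x : R => (1 - x) / (1 + x)) x 1.
  by apply: derivableM; [exact: ex_derive|apply: derivableV].
have q0 : 0 < (1 - x) / (1 + x) by rewrite divr_gt0.
have dln := @is_derive1_ln R _ q0.
apply: derivableD; last exact: ex_derive.
apply: derivableM; first exact: ex_derive.
exact: ex_derive.
Qed.

(** Since [f] vanishes at [beta], the mean value theorem on [[x, beta]] gives
    [f x <= kappa (beta - x)]. *)
Lemma fpot_add_bound (p : potential R) (beta kappa : R) : potential_ok p beta ->
  (forall x, - beta <= x <= beta -> `|derive1 (fpot p) x| <= kappa) ->
  forall x, - beta <= x <= beta -> fpot p x + kappa * x <= kappa * beta.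
Proof.
move=> ok dk x /andP[xb bx].
have fb : fpot p beta = 0.
  by case: p ok {dk} => [->/=|th thc [_ [_ [_ [_]]]]//]; ring.
have df := fpot_derivable p beta ok.
have kap0 : 0 <= kappa.
  by apply: le_trans (dk x _); [exact: normr_ge0|rewrite xb].
have dfx c : x <= c <= beta -> is_derive c 1 (fpot p) (derive1 (fpot p) c).
  move=> /andP[xc cb]; rewrite derive1E; apply: derivableP; apply: df.
  by rewrite (le_trans xb xc).
have cf : {within `[x, beta], continuous (fpot p)}.
  by apply: derivable_within_continuous => c; rewrite in_itv/= => /dfx dc; exact: ex_derive.
have [|c] := @MVT_segment R (fpot p) (derive1 (fpot p)) x beta bx _ cf.
  move=> c; rewrite in_itv/= => /andP[xc cb].
  by apply: dfx; rewrite !ltW.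
rewrite in_itv/= => /andP[xc cb]; rewrite fb => E.
have /dk : - beta <= c <= beta by rewrite (le_trans xb xc).
rewrite ler_norml => /andP[kc _].
have : - kappa * (beta - x) <= derive1 (fpot p) c * (beta - x) by rewrite ler_wpM2r ?subr_ge0.
by rewrite -E; lra.
Qed.

End MaxPrinciple.

(** * Upper bound across one time step *)

Section Step.
Context {R : realType}.
Variables (alpha : R) (tau : nat -> R) (N : nat).
Hypothesis alpha01 : 0 < alpha < 1.
Hypothesis tau_gt0 : forall k, (1 <= k <= N)%N -> 0 < tau k.
Hypothesis ratio_ge : forall k, (2 <= k <= N)%N -> 4 / 7 <= step_ratio tau k.
Let sg : R := alpha / 2.

Lemma time_step_le_Bcoef (m C : R) (n : nat) : 0 < m -> 0 < C -> (1 <= n <= N)%N ->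
  tau n <= powR (4 / (11 * (1 - sg) * m * C * GammaF (2 - alpha))) (1 / alpha) ->
  m * (1 - sg) * C <= Bcoef tau alpha n n.
Proof.
move=> m0 C0 nN; have tn := tau_gt0 n nN; have [a0 a1] := andP alpha01.
have sg1 : 2^-1 < 1 - sg by rewrite /sg; lra.
have sg0 : 0 < 1 - sg by lra.
have G0 : 0 < GammaF (2 - alpha) by apply: GammaF_gt0; lra.
set Y := 4 / _ => tY.
have Y0 : 0 < Y by rewrite divr_gt0// !mulr_gt0.
have {}tY : powR (tau n) alpha <= Y.
  have -> : Y = powR (powR Y (1 / alpha)) alpha.
    by rewrite -powRrM div1r mulVf ?gt_eqF// powRr1// ltW.
  by apply: ge0_ler_powR; rewrite ?nnegrE ?powR_ge0 ?(ltW a0) ?(ltW tn).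
apply: le_trans (acoef_le_Bcoef_last alpha tau N alpha01 tau_gt0 ratio_ge n nN).
rewrite (acoef_last alpha tau N)// -/sg powRN.
have P0 : 0 < powR (tau n) alpha by rewrite powR_gt0.
(* As [1 - sg] lies in []1/2, 1[], its power with exponent [1 - alpha] exceeds 1/2; the step
   restriction asks only for 4/11. *)
apply: (@le_trans _ _ (2^-1 / powR (tau n) alpha / GammaF (2 - alpha))); last first.
  rewrite !ler_pM2r ?invr_gt0//; apply/ltW/(lt_le_trans sg1).
  by apply: ger1_powR; rewrite /sg; lra.
rewrite ler_pdivlMr// ler_pdivlMr// -ler_pdivlMl ?mulr_gt0//.
apply: (le_trans tY); rewrite /Y -subr_ge0.
rewrite [leRHS](_ : _ = (2^-1 - 4 / 11) * ((m * (1 - sg) * C * GammaF (2 - alpha))^-1)); last first.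
  by field; rewrite !gt_eqF.
by rewrite mulr_ge0 ?invr_ge0 ?mulr_ge0//; lra.
Qed.

(** With [alpha = 2 sg], [1 - (1 - alpha) / (1 - sg) = sg / (1 - sg)]. At [n = 1] there is no older
    weight and [sg <= 1 - sg] suffices. *)
Lemma Bcoef_gap (m C : R) (n : nat) : 0 < m -> 0 < C -> (1 <= n <= N)%N ->
  m * (1 - sg) * C <= Bcoef tau alpha n n ->
  m * sg * C <= Bcoef tau alpha n n - (if n == 1%N then 0 else Bcoef tau alpha n n.-1).
Proof.
move=> m0 C0 nN mB; have [a0 a1] := andP alpha01.
have sg1 : 0 < 1 - sg by rewrite /sg; lra.
have mC : 0 < m * C by rewrite mulr_gt0.
have [n1|n1] := eqVneq n 1%N.
  rewrite subr0; apply: le_trans mB.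
  by rewrite -!(mulrAC m C) ler_pM2l// /sg; lra.
have n2 : (1 < n <= N)%N by case/andP: nN => n0 ->; rewrite ltn_neqAle eq_sym n1 n0.
have := Bcoef_prelast_le alpha tau N alpha01 tau_gt0 ratio_ge n n2; rewrite -/sg => P.
rewrite lerBrDr -lerBrDl; apply: (le_trans P); rewrite lerBrDl -lerBrDr.
rewrite [leRHS](_ : _ = sg / (1 - sg) * Bcoef tau alpha n n); last first.
  by rewrite /sg; field; rewrite gt_eqF//; move: sg1; rewrite /sg; lra.
have E : m * sg * C = sg / (1 - sg) * (m * (1 - sg) * C) by field; rewrite gt_eqF.
by rewrite E ler_pM2l// divr_gt0// /sg divr_gt0.
Qed.

(** One-sided and with a general source [F], so that it applies to both [phi] and its negative. *)
Lemma step_le (M : nat) (m eps kappa h beta : R) (v : nat -> grid R M) (F : grid R M) (n : nat) :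
  0 < m -> 0 < eps -> 0 <= kappa -> 0 < h -> 0 <= beta -> (1 <= n <= N)%N ->
  m * (1 - sg) * (4 * eps ^+ 2 / h ^+ 2 + kappa) <= Bcoef tau alpha n n ->
  (forall k, (k < n)%N -> forall i j, v k i j <= beta) ->
  (forall i j, F i j <= kappa * beta) ->
  (forall i j, caputo tau alpha v n i j =
     m * (eps ^+ 2 * lap_h h (fun i j => (1 - sg) * v n i j + sg * v n.-1 i j) i j
          - kappa * ((1 - sg) * v n i j + sg * v n.-1 i j) + F i j)) ->
  forall i j, v n i j <= beta.
Proof.
move=> m0 eps0 kap0 h0 beta0 nN Bnn vb Fb eqn.
have [n0 nN'] := andP nN; have [a0 a1] := andP alpha01.
have sg0 : 0 < sg by rewrite /sg divr_gt0.
have sg1 : 0 < 1 - sg by rewrite /sg; lra.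
have C0 : 0 < 4 * eps ^+ 2 / h ^+ 2 + kappa.
  by rewrite ltr_wpDr// divr_gt0 ?mulr_gt0 ?exprn_gt0.
have B0 : 0 < Bcoef tau alpha n n by apply: lt_le_trans Bnn; rewrite !mulr_gt0.
have gap := Bcoef_gap m _ n m0 C0 nN Bnn.
set B' := (if _ then _ else _) in gap.
(* The implicit parts of diffusion and stabilization stay on the left; everything else must be
   bounded by [c * beta]. *)
apply: (discrete_max_principle M h (m * eps ^+ 2 * (1 - sg))
   (Bcoef tau alpha n n + m * kappa * (1 - sg))).
- by rewrite !mulr_ge0 ?sqr_ge0 ?ltW.
- by rewrite ltr_wpDr// !mulr_ge0// ltW.
move=> i j.
have nE : n = n.-1.+1 by rewrite prednK.
have vn1 : v n.-1 i j <= beta by apply: vb; rewrite prednK.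
have L1 := lap_h_le M h beta (v n.-1) i j (vb n.-1 (eq_leq (prednK n0))).
have := eqn i j; rewrite lap_h_lin /caputo {1}nE big_nat_recr//= prednK//.
set S := \sum_(1 <= k < n) _ => E.
have HS : B' * v n.-1 i j - S <= B' * beta.
  rewrite /B'; have [n1|n1] := eqVneq n 1%N.
    by rewrite /S n1 big_geq// !mul0r subr0.
  have n2 : (0 < n.-1)%N by rewrite -ltnS prednK// ltn_neqAle eq_sym n1 n0.
  have := @history_le R (Bcoef tau alpha n) (fun k => v k i j) beta n.-1 beta0 n2.
  rewrite prednK//; apply.
  - by apply: (Bcoef_first_ge0 alpha tau N) => //; rewrite nN' andbT -(prednK n0) ltnS.
  - move=> k k1 kn; apply: (Bcoef_le alpha tau N) => //.
    by rewrite nN' andbT -(prednK n0) ltnS.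
  - by move=> k kn; apply: vb; rewrite -(prednK n0) ltnS.
have mF : m * F i j <= m * (kappa * beta) by rewrite ler_pM2l.
(* The gap between the two newest weights pays for the explicit parts, of weight [sg], of both
   diffusion and stabilization. *)
have gap' : m * sg * (4 * eps ^+ 2 / h ^+ 2 + kappa) * (beta - v n.-1 i j)
    <= (Bcoef tau alpha n n - B') * (beta - v n.-1 i j).
  by rewrite ler_wpM2r ?subr_ge0.
have L1' : m * sg * eps ^+ 2 * lap_h h (v n.-1) i j <=
    m * sg * eps ^+ 2 * (4 / h ^+ 2 * (beta - v n.-1 i j)).
  by rewrite ler_wpM2l// !mulr_ge0 ?sqr_ge0 ?ltW.
(* Once the grid values are abstracted, the goal is the plain sum of [E], [HS], [mF], [gap'] and
   [L1']. *)
move: E HS mF gap' L1'; clear gap.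
move: (Bcoef _ _ _ _) B' S (lap_h _ (v n) _ _) (lap_h _ (v n.-1) _ _) (v n i j) (v n.-1 i j) (F i j) (h ^+ 2)^-1 (eps ^+ 2).
move=> B B1 S Ln Lp x y f H e E HS mF gap' L1'.
lra.
Qed.
End Step.

(** * Bounds on the predictor and induction over time levels *)

Section Bounds.
Context {R : realType}.

Lemma clamp_bound (beta x : R) : 0 <= beta -> - beta <= clamp beta x <= beta.
Proof.
move=> b0; rewrite /clamp ge_min lexx orbT andbT le_min le_max lexx orbT/=; lra.
Qed.

Lemma potential_ok_ge0 (p : potential R) (beta : R) : potential_ok p beta -> 0 <= beta.
Proof. by case: p => [->|th thc [_ [_ [/ltW]]]]. Qed.
End Bounds.

Theorem mainTheorem12 (R : realType) (p : potential R) (beta : R)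
  (V : R -> R) (K1 : R)
  (m eps alpha kappa L : R) (M N : nat) (tau : nat -> R)
  (phi : nat -> grid R M) (Rs : nat -> R) (hat1 : grid R M) :
  potential_ok p beta ->
  0 < m -> 0 < eps -> 0 < alpha < 1 -> 0 < L -> (0 < M)%N ->
  (forall k, (1 <= k <= N)%N -> 0 < tau k) ->
  0 <= kappa ->
  (* (A1)-(A3) with K2 = 1 *)
  V_assumptions V K1 1 ->
  (* r_k >= 4/7 *)
  (forall k, (2 <= k <= N)%N -> 4 / 7 <= step_ratio tau k) ->
  (* kappa >= || f' ||_{C[-beta, beta]} *)
  (forall x, - beta <= x <= beta -> `|derive1 (fpot p) x| <= kappa) ->
  normInf (phi 0%N) <= beta ->
  (let sg := alpha / 2 in
   let h := L / M%:R in
   ((1 <= N)%N ->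
     tau 1%N <= Num.min
       (powR (4 / (11 * sg * m * (kappa + 4 * eps ^+ 2 / h ^+ 2)
                   * GammaF (2 - alpha))) (1 / alpha))
       (powR (4 / (11 * kappa * (1 - sg) * m * GammaF (2 - alpha))) (1 / alpha))) /\
   (forall n, (1 <= n <= N)%N ->
     tau n <= powR (4 / (11 * (1 - sg) * m * (4 * eps ^+ 2 / h ^+ 2 + kappa)
                         * GammaF (2 - alpha))) (1 / alpha))) ->
  scheme_solution p beta V m eps alpha kappa L N tau phi Rs hat1 ->
  forall n, (1 <= n <= N)%N -> normInf (phi n) <= beta.
Proof.
move=> ok m0 eps0 alpha01 L0 M0 tau0 kap0 Vok ratio dk phi0 /= [_ tau_le] [hat1P sch].
have [a0 a1] := andP alpha01.
have beta0 := potential_ok_ge0 p beta ok.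
have V01 x : 0 <= V x <= 1 by case: Vok => _ [_ [_ [_ [_ [_ [_ [+ _]]]]]]]; apply.
have h0 : 0 < L / M%:R by rewrite divr_gt0 ?ltr0n.
set h := L / M%:R in h0 tau_le sch; clearbody h.
set sg := alpha / 2 in tau_le sch.
have sg0 : 0 < sg by rewrite /sg divr_gt0.
have sg1 : 0 < 1 - sg by rewrite /sg; lra.
have C0 : 0 < 4 * eps ^+ 2 / h ^+ 2 + kappa.
  by rewrite ltr_wpDr// divr_gt0 ?mulr_gt0 ?exprn_gt0.
suff H n : (n <= N)%N -> forall i j, - beta <= phi n i j <= beta.
  by move=> n /andP[_ nN]; exact/(normInfP _ _ _ beta0)/H.
(* Strong induction, because the discrete Caputo sum involves every earlier level. *)
elim/ltn_ind: n => -[_ _|n IH nN]; first exact/(normInfP _ _ _ beta0).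
have nN' : (1 <= n.+1 <= N)%N by [].
have {}IH k : (k < n.+1)%N -> forall i j, - beta <= phi k i j <= beta.
  by move=> kn; apply: IH => //; exact: leq_trans (ltnW kn) nN.
have hatP i j : - beta <= hatphi tau beta phi hat1 n.+1 i j <= beta.
  rewrite /hatphi; case: ifP => _; last exact: clamp_bound.
  exact: ((normInfP _ _ _ beta0).2 (hat1P (leq_trans (ltn0Sn n) nN)).1).
have [eqn _] := sch n.+1 nN'.
set hs := (fun i j => (1 - sg) * hatphi tau beta phi hat1 n.+1 i j + sg * phi n.+1.-1 i j) in eqn.
have hsP i j : - beta <= hs i j <= beta.
  have /andP[p1 p2] := hatP i j; have /andP[q1 q2] := IH n (ltnSn n) i j.
  have := ler_wpM2l (ltW sg1) p1; have := ler_wpM2l (ltW sg1) p2.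
  have := ler_wpM2l (ltW sg0) q1; have := ler_wpM2l (ltW sg0) q2.
  by rewrite /hs/= => *; apply/andP; split; lra.
set Vn := V _ in eqn.
have /andP[V0 V1] : 0 <= Vn <= 1 by exact: V01.
have B_ge := time_step_le_Bcoef alpha tau N alpha01 tau0 ratio m _ n.+1 m0 C0 nN' (tau_le _ nN').
(* [Vn] multiplies both the reaction and the extrapolated stabilization, so they group into
   [f x + kappa x]. *)
pose F : grid R M := fun i j => Vn * (fpot p (hs i j) + kappa * hs i j).
have kb0 : 0 <= kappa * beta by rewrite mulr_ge0.
(* Valid for [x] of either sign, because [0 <= Vn <= 1] and [kappa * beta >= 0]. *)
have Vle x : x <= kappa * beta -> Vn * x <= kappa * beta.
  move=> xk; apply: (@le_trans _ _ (Vn * (kappa * beta))); first by rewrite ler_wpM2l.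
  by rewrite ler_piMl.
have F_le i j : F i j <= kappa * beta.
  by apply: Vle; apply: fpot_add_bound.
have F_ge i j : - F i j <= kappa * beta.
  rewrite /F -mulrN; apply: Vle.
  rewrite opprD -(fpot_odd p beta ok)// -mulrN; apply: fpot_add_bound => //.
  by have /andP[] := hsP i j; lra.
have up : forall i j, phi n.+1 i j <= beta.
  apply: (step_le alpha tau N alpha01 tau0 ratio M m eps kappa h beta phi F n.+1) => //.
    by move=> k kn i j; have /andP[] := IH k kn i j.
  by move=> i j; rewrite eqn /F; congr (m * _); rewrite -/sg /hs/=; ring.
(* By linearity, [- phi] satisfies the same step equation with source [- F]. *)
have dn : forall i j, - phi n.+1 i j <= beta.
  apply: (step_le alpha tau N alpha01 tau0 ratio M m eps kappa h beta
    (fun k i j => - phi k i j) (fun i j => - F i j) n.+1) => //.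
    by move=> k kn i j; have /andP[] := IH k kn i j; rewrite lerNl.
  move=> i j; transitivity (- caputo tau alpha phi n.+1 i j).
    by rewrite /caputo -sumrN; apply: eq_bigr => k _; ring.
  by rewrite eqn /F /hs (lap_h_lin _ _ _ _ (fun i j => - phi n.+1 i j)) lap_h_lin !lap_hN -/sg /=; ring.
by move=> i j; rewrite up andbT lerNl dn.
Qed.
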